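(* Let $f,g\in\mathbb{C}[x^{\pm1},y^{\pm1},z^{\pm1}]$ be Laurent polynomials that are related by a mutation $\varphi:(\mathbb{C}^\times)^3\dashrightarrow(\mathbb{C}^\times)^3$ (that is, $\varphi^\star f=g$). Then the periods of $f$ and $g$ coincide: $\pi_f(t)=\pi_g(t)$.
   Context: Period: for a Laurent polynomial $f\in\mathbb{C}[x^{\pm1},y^{\pm1},z^{\pm1}]$, the period of $f$ is the function of one complex variable $$\pi_f(t)=\left(\frac{1}{2\pi i}\right)^3\int_{|x|=|y|=|z|=1}\frac{1}{1-tf(x,y,z)}\frac{dx}{x}\frac{dy}{y}\frac{dz}{z},$$ defined for $|t|$ sufficiently small. Its Taylor expansion is $\pi_f(t)=\sum_{k\ge0}c_kt^k$, where $c_k$ is the coefficient of the unit monomial in $f^k$. $\mathrm{GL}_3(\mathbb{Z})$-equivalence: an isomorphism $(\mathbb{C}^\times)^3\to(\mathbb{C}^\times)^3$ of the form $(x,y,z)\mapsto(x^ay^bz^c,\,x^dy^ez^f,\,x^gy^hz^i)$ where $\begin{pmatrix} a & b & c \\ d & e & f \\ g & h & i \end{pmatrix}\in\mathrm{GL}_3(\mathbb{Z})$. Mutation: a birational transformation $(\mathbb{C}^\times)^3\dashrightarrow(\mathbb{C}^\times)^3$ that is a composition of (1) a $\mathrm{GL}_3(\mathbb{Z})$-equivalence; (2) a birational transformation of the form $(x,y,z)\mapsto(x,y,A(x,y)z)$ with $A$ a (nonzero) Laurent polynomial in $x,y$; and (3) another $\mathrm{GL}_3(\mathbb{Z})$-equivalence.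 If $f,g$ are Laurent polynomials and $\varphi$ is a mutation such that the pullback $\varphi^\star f$ equals $g$, then $f$ and $g$ are said to be related by the mutation $\varphi$. *)

(* Defs.v *)
From HB Require Import structures.
From mathcomp Require Import all_boot all_order all_algebra.
From mathcomp Require Import finmap complex.
From mathcomp Require Import all_classical all_reals all_analysis.

Set Implicit Arguments.
Unset Strict Implicit.
Unset Printing Implicit Defensive.

Import Order.TTheory GRing.Theory Num.Theory.
Local Open Scope classical_set_scope.
Local Open Scope complex_scope.
Local Open Scope ring_scope.

(* A Laurent polynomial in n variables over K is given by its coefficients:
   f m is the coefficient of the monomial x_0 ^ m_0 * ... * x_(n-1) ^ m_(n-1). *)
Definition laurent (K : fieldType) (n : nat) : Type :=
  {fsfun 'rV[int]_n -> K with 0}.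

Definition monomial (K : fieldType) (n : nat) (m : 'rV[int]_n) (p : 'rV[K]_n)
  : K := \prod_(j < n) p 0 j ^ m 0 j.

Definition leval (K : fieldType) (n : nat) (f : laurent K n) (p : 'rV[K]_n)
  : K := \sum_(m <- finsupp f) f m * monomial m p.

Definition in_torus (K : fieldType) (n : nat) (p : 'rV[K]_n) : Prop :=
  forall j, p 0 j != 0.

Definition pt3 (K : fieldType) (x y z : K) : 'rV[K]_3 :=
  \row_j tnth [tuple x; y; z] j.

(* A rational self-map of the three-dimensional torus, as a partial function on
   points: None means that the map is not defined, as a map to the torus, at
   that point. Only the values at points of the torus matter. *)
Definition ratmap3 (K : fieldType) : Type := 'rV[K]_3 -> option 'rV[K]_3.

Definition monomial_map (K : fieldType) (M : 'M[int]_3) : ratmap3 K :=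
  fun p => Some (\row_i monomial (row i M) p).

Definition is_gl3_equivalence (K : fieldType) (T : ratmap3 K) : Prop :=
  exists2 M : 'M[int]_3, M \in unitmx & T =1 monomial_map M.

(* (x, y, z) |-> (x, y, A(x, y) z), which lands in the torus exactly where
   A(x, y) != 0. *)
Definition shear (K : fieldType) (A : laurent K 2) : ratmap3 K := fun p =>
  let x := p 0 0 in let y := p 0 1 in let z := p 0 2%:R in
  let a := leval A (\row_j tnth [tuple x; y] j) in
  if a == 0 then None else Some (pt3 x y (a * z)).

Definition is_shear (K : fieldType) (S : ratmap3 K) : Prop :=
  exists2 A : laurent K 2, finsupp A != fset0 & S =1 shear A.

Definition is_mutation (K : fieldType) (phi : ratmap3 K) : Prop :=
  exists T1 S T2 : ratmap3 K,
    [/\ is_gl3_equivalence T1, is_shear S, is_gl3_equivalence T2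
      & phi =1 pcomp T2 (pcomp S T1)].

(* The pullback of f by phi is g, as rational functions on the torus, i.e.,
   f o phi and g agree wherever phi is defined. *)
Definition pullback_eq (K : fieldType) (phi : ratmap3 K) (f g : laurent K 3)
  : Prop :=
  forall p q, in_torus p -> phi p = Some q -> leval f q = leval g p.

Section Period.
Variable R : realType.
Local Notation C := R[i].

Definition Cintegral (d : measure_display) (T : measurableType d)
    (mu : {measure set T -> \bar R}) (D : set T) (h : T -> C) : C :=
  (Rintegral mu D (fun x => complex.Re (h x)))
  +i* (Rintegral mu D (fun x => complex.Im (h x))).

Definition expi (u : R) : C := cos u +i* sin u.

(* The integral of the 3-form h(x, y, z) dx dy dz over |x| = |y| = |z| = 1,
   with x = e^(iu), dx = i e^(iu) du for u in [0, 2 pi], and so on. *)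
Definition torus_integral (h : C -> C -> C -> C) : C :=
  let I := `[0, 2 * pi]%classic : set R in
  Cintegral ((lebesgue_measure \x lebesgue_measure) \x lebesgue_measure)%E
    ((I `*` I) `*` I)
    (fun u : R * R * R =>
       let x := expi u.1.1 in let y := expi u.1.2 in let z := expi u.2 in
       h x y z * ('i%C * x) * ('i%C * y) * ('i%C * z)).

(* Meaningful for small t, when 1 - t f has no zero on |x| = |y| = |z| = 1. *)
Definition period (f : laurent C 3) (t : C) : C :=
  ((2 * pi)%:C * 'i%C)^-1 ^+ 3 *
  torus_integral (fun x y z => (1 - t * leval f (pt3 x y z))^-1 / x / y / z).

End Period.

(* Main.v *)
(* Integrating the geometric series of 1 / (1 - t f) over the torus shows that,
   for small t, the period of f is the sum of c_k t^k, where c_k is the constant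
   term of f^k; so it suffices that f^k and g^k have the same constant term. A
   monomial change of coordinates does not move the exponent 0. For a shear,
   f(x, y, A(x, y) z) = g(x, y, z), the part of f^k of degree 0 in z is not
   affected by the rescaling of z, so it agrees with that of g^k wherever
   A(x, y) != 0, hence identically. *)
Require Import Defs.
From HB Require Import structures.
From mathcomp Require Import all_boot all_order all_algebra.
From mathcomp Require Import finmap complex.
From mathcomp Require Import all_classical all_reals all_analysis.
From mathcomp Require Import measurable_realfun.
From mathcomp Require Import zify ring lra.

Set Implicit Arguments.
Unset Strict Implicit.
Unset Printing Implicit Defensive.

Import Order.TTheory GRing.Theory Num.Theory.
Import numFieldNormedType.Exports.
Local Open Scope classical_set_scope.
Local Open Scope complex_scope.
Local Open Scope ring_scope.

(** * Constant terms of Laurent polynomials *)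

Section Univariate.
Variable K : numFieldType.
Implicit Types (s a : seq (K * int)) (x : K).

Definition laurent1_eval s x : K := \sum_(i <- s) i.1 * x ^ i.2.
Definition laurent1_coef s (e : int) : K := \sum_(i <- s | i.2 == e) i.1.

(** In characteristic 0 the elements 0, 1, ..., [size p] - 1 are distinct, hence too many roots for
    a nonzero [p]. *)
Lemma poly_horner_eq0 (p : {poly K}) : (forall x, p.[x] = 0) -> p = 0.
Proof.
move=> p0; apply/eqP; apply: contraT => pn0.
have := @max_poly_roots K p [seq i%:R | i <- iota 0 (size p)] pn0.
rewrite size_map size_iota ltnn => -> //.
  by apply/allP => x _; rewrite rootE p0.
by rewrite map_inj_uniq ?iota_uniq // => i j /eqP; rewrite eqr_nat => /eqP.
Qed.

(** Multiplying by [x ^+ E] clears the negative exponents. The index [j] is left unspecified because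
    the only use is to see that all Laurent coefficients vanish once [p = 0]. *)
Lemma laurent1_poly s : exists (E : nat) (p : {poly K}),
  (forall x, x != 0 -> p.[x] = x ^+ E * laurent1_eval s x) /\
  (forall e, exists j : nat, laurent1_coef s e = p`_j).
Proof.
have [E sE] : exists E : nat, forall i, i \in s -> 0 <= i.2 + E%:Z.
  exists (\sum_(i <- s) absz i.2)%N => i si.
  rewrite (big_rem i si) /=; lia.
set p := \sum_(i <- s) i.1 *: 'X^(absz (i.2 + E%:Z)).
have pE j : p`_j = laurent1_coef s (j%:Z - E%:Z).
  rewrite coef_sum /laurent1_coef [RHS]big_mkcond !big_seq.
  apply: eq_bigr => i /sE iE; rewrite coefZ coefXn.
  have -> : (j == absz (i.2 + E%:Z)) = (i.2 == j%:Z - E%:Z) by lia.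
  by case: ifP; rewrite ?mulr1 ?mulr0.
exists E, p; split=> [x x0|e].
  rewrite horner_sum mulr_sumr !big_seq; apply: eq_bigr => i /sE iE.
  rewrite hornerZ hornerXn mulrCA; congr (_ * _).
  by rewrite !exprnP abszE ger0_norm // expfzDr // mulrC.
have [eE|eE] := leP 0 (e + E%:Z).
  by exists (absz (e + E%:Z)); rewrite pE abszE ger0_norm // addrK.
(* No exponent of [s] lies below [-E], so the coefficient is 0; any index past the end of [p]
   represents it. *)
exists (size p); rewrite nth_default // /laurent1_coef big_seq_cond big1 // => i.
by move=> /andP[/sE iE /eqP ie]; rewrite ie leNgt eE in iE.
Qed.

(** Density of the locus where [a] is nonzero: after denominators are cleared, the product of the
    two polynomials vanishes everywhere, and polynomials form an integral domain. *)
Lemma laurent1_coef_eq0 s a (e0 : int) : laurent1_coef a e0 != 0 ->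
  (forall x, x != 0 -> laurent1_eval a x != 0 -> laurent1_eval s x = 0) ->
  forall e, laurent1_coef s e = 0.
Proof.
move=> ae0 sa e.
have [Ea [p [pE pc]]] := laurent1_poly a.
have [Es [q [qE qc]]] := laurent1_poly s.
(* The factor ['X] takes care of the point 0, where the Laurent evaluations say nothing about [p]
   and [q]. *)
have : 'X * p * q = 0.
  apply: poly_horner_eq0 => x; rewrite !hornerE.
  have [->|x0] := eqVneq x 0; first by rewrite !mul0r.
  rewrite pE // qE //.
  have [->|/(sa _ x0)->] := eqVneq (laurent1_eval a x) 0.
    by rewrite !(mulr0, mul0r).
  by rewrite !mulr0.
move/eqP; rewrite !mulf_eq0 polyX_eq0 /= => /orP[]/eqP p0.
  by case/eqP: ae0; have [j ->] := pc e0; rewrite p0 coef0.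
by have [j ->] := qc e; rewrite p0 coef0.
Qed.
End Univariate.

(* A list of pairs (coefficient, exponent), possibly with repeated exponents,
   stands for a Laurent polynomial. *)
Section LaurentSum.
Variable K : numFieldType.

Definition lsum n (s : seq (K * 'rV[int]_n)) (p : 'rV[K]_n) : K :=
  \sum_(i <- s) i.1 * monomial i.2 p.

Definition lconst n (s : seq (K * 'rV[int]_n)) : K :=
  \sum_(i <- s | i.2 == 0) i.1.

Definition lterms n (f : laurent K n) : seq (K * 'rV[int]_n) :=
  [seq (f m, m) | m <- finsupp f].

Definition lpow n (s : seq (K * 'rV[int]_n)) (k : nat) :=
  iter k (fun r => [seq (i.1 * j.1, i.2 + j.2) | i <- s, j <- r])
    [:: (1, 0)].

(** Pullback along the monomial map of [M]: substituting monomials acts linearly on exponent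
    rows. *)
Definition lpull n (M : 'M[int]_n) (s : seq (K * 'rV[int]_n)) :=
  [seq (i.1, i.2 *m M) | i <- s].

Lemma lsum_lterms n (f : laurent K n) p : lsum (lterms f) p = leval f p.
Proof. by rewrite /lsum big_map. Qed.

Lemma monomial0 n (p : 'rV[K]_n) : monomial 0 p = 1.
Proof. by rewrite /monomial big1 // => j _; rewrite mxE expr0z. Qed.

Lemma monomial_delta n (j : 'I_n) (p : 'rV[K]_n) :
  monomial (delta_mx 0 j) p = p 0 j.
Proof.
rewrite /monomial (bigD1 j) //= mxE !eqxx expr1z big1 ?mulr1 // => i ij.
by rewrite mxE eqxx /= (negbTE ij) expr0z.
Qed.

Lemma monomialD n (m m' : 'rV[int]_n) (p : 'rV[K]_n) : in_torus p ->
  monomial (m + m') p = monomial m p * monomial m' p.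
Proof.
move=> p0; rewrite /monomial -big_split /=; apply: eq_bigr => j _.
by rewrite mxE expfzDr.
Qed.

Lemma monomial_neq0 n (m : 'rV[int]_n) (p : 'rV[K]_n) : in_torus p ->
  monomial m p != 0.
Proof.
by move=> p0; apply/prodf_neq0 => j _; rewrite expfz_neq0.
Qed.

Lemma lsum_lpow n (s : seq (K * 'rV[int]_n)) k p : in_torus p ->
  lsum (lpow s k) p = lsum s p ^+ k.
Proof.
move=> p0; elim: k => [|k IH].
  by rewrite /lsum big_seq1 /= monomial0 mulr1.
rewrite exprS -IH /lsum /= big_allpairs_dep /= mulr_suml.
apply: eq_bigr => i _; rewrite mulr_sumr; apply: eq_bigr => j _ /=.
by rewrite monomialD // mulrACA.
Qed.

Lemma monomial_mulmx n (m : 'rV[int]_n) (M : 'M[int]_n) (p : 'rV[K]_n) :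
  in_torus p -> monomial (m *m M) p = monomial m (\row_i monomial (row i M) p).
Proof.
move=> p0; rewrite /monomial.
transitivity (\prod_j \prod_i (p 0 j ^ M i j) ^ m 0 i).
  apply: eq_bigr => j _; rewrite mxE.
  rewrite (big_morph _ (fun a b => expfzDr a b (p0 j)) (expr0z _)).
  by apply: eq_bigr => i _; rewrite mulrC exprz_exp.
rewrite exchange_big; apply: eq_bigr => i _ /=.
rewrite mxE (big_morph _ (fun x y => expfzMl x y (m 0 i)) (exp1rz _ _)).
by apply: eq_bigr => j _; rewrite mxE.
Qed.

Lemma torus_monomial_map n (M : 'M[int]_n) (p : 'rV[K]_n) : in_torus p ->
  in_torus (\row_i monomial (row i M) p).
Proof. by move=> p0 j; rewrite mxE monomial_neq0. Qed.

Lemma lsum_lpull n (M : 'M[int]_n) s (p : 'rV[K]_n) : in_torus p ->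
  lsum (lpull M s) p = lsum s (\row_i monomial (row i M) p).
Proof.
by move=> p0; rewrite /lsum big_map; apply: eq_bigr => i _; rewrite monomial_mulmx.
Qed.

Lemma lpow_lpull n (M : 'M[int]_n) (s : seq (K * 'rV[int]_n)) k :
  lpow (lpull M s) k = lpull M (lpow s k).
Proof.
elim: k => [|k IH]; first by rewrite /= /lpull /= mul0mx.
rewrite /= IH /lpull map_allpairs allpairs_mapl /=.
rewrite (allpairs_mapr (fun=> _)) /=.
by apply: eq_allpairs => // i j; rewrite mulmxDl.
Qed.

Lemma lconst_lpull n (M : 'M[int]_n) (s : seq (K * 'rV[int]_n)) :
  M \in unitmx -> lconst (lpull M s) = lconst s.
Proof.
move=> Mu; rewrite /lconst big_map; apply: eq_bigl => i /=.
by apply/eqP/eqP => [/(congr1 (mulmx^~ (invmx M)))|->]; rewrite ?mul0mx ?mulmxK.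
Qed.

Lemma monomial_pt3 (m : 'rV[int]_3) (x y z : K) :
  monomial m (pt3 x y z) = x ^ m 0 0 * y ^ m 0 1 * z ^ m 0 2%:R.
Proof.
rewrite /monomial !big_ord_recl big_ord0 mulr1 !mxE /= mulrA.
congr (_ ^ m _ _ * _ ^ m _ _ * _ ^ m _ _); exact/val_inj.
Qed.

Lemma lsum_pt3 (s : seq (K * 'rV[int]_3)) x y z : lsum s (pt3 x y z) =
  \sum_(i <- s) i.1 * (x ^ i.2 0 0 * y ^ i.2 0 1 * z ^ i.2 0 2%:R).
Proof. by apply: eq_bigr => i _; rewrite monomial_pt3. Qed.

Lemma lsum_pt2 (s : seq (K * 'rV[int]_2)) x y :
  lsum s (\row_j tnth [tuple x; y] j) =
  \sum_(i <- s) i.1 * (x ^ i.2 0 0 * y ^ i.2 0 1).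
Proof.
apply: eq_bigr => i _; congr (_ * _).
rewrite /monomial !big_ord_recl big_ord0 mulr1 !mxE /=.
congr (_ ^ i.2 _ _ * _ ^ i.2 _ _); exact/val_inj.
Qed.

Lemma in_torus_pt3 (x y z : K) :
  x != 0 -> y != 0 -> z != 0 -> in_torus (pt3 x y z).
Proof.
by move=> x0 y0 z0 [[|[|[|//]]] ?]; rewrite mxE.
Qed.

Lemma laurent1_eval_cat (s t : seq (K * int)) x :
  laurent1_eval (s ++ t) x = laurent1_eval s x + laurent1_eval t x.
Proof. by rewrite /laurent1_eval big_cat. Qed.

Lemma laurent1_coef_cat (s t : seq (K * int)) e :
  laurent1_coef (s ++ t) e = laurent1_coef s e + laurent1_coef t e.
Proof. by rewrite /laurent1_coef big_cat. Qed.

(* The coefficient of z ^ 0, evaluated at (x, y). *)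
Definition lzconst (s : seq (K * 'rV[int]_3)) (x y : K) :=
  \sum_(i <- s | i.2 0 2%:R == 0) i.1 * (x ^ i.2 0 0 * y ^ i.2 0 1).

(** With [x] and [y] fixed, both sides are Laurent polynomials in [z]. Replacing [z] by [a * z]
    multiplies the coefficient of [z ^ e] by [a ^ e], which is 1 at [e = 0]. *)
Lemma lzconst_scale (s t : seq (K * 'rV[int]_3)) (x y a : K) : a != 0 ->
  (forall z, z != 0 -> lsum s (pt3 x y (a * z)) = lsum t (pt3 x y z)) ->
  lzconst s x y = lzconst t x y.
Proof.
move=> a0 st.
pose r1 := [seq (i.1 * (x ^ i.2 0 0 * y ^ i.2 0 1 * a ^ i.2 0 2%:R), i.2 0 2%:R)
  | i : K * 'rV[int]_3 <- s].
pose r2 := [seq (- (i.1 * (x ^ i.2 0 0 * y ^ i.2 0 1)), i.2 0 2%:R)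
  | i : K * 'rV[int]_3 <- t].
(* The list [[:: (1, 0)]] is the constant 1, so only [z = 0] is excluded; [r1 ++ r2] encodes the
   difference of the two sides. *)
have := @laurent1_coef_eq0 K (r1 ++ r2) [:: (1, 0)] 0.
rewrite {1}/laurent1_coef big_mkcond big_seq1 /= oner_eq0 => /(_ isT) H.
have {H} := H _ 0; rewrite laurent1_coef_cat /laurent1_coef !big_map /= => H.
apply/eqP; rewrite -subr_eq0 -sumrN -[X in _ == X]H; first last.
  move=> z z0 _; rewrite laurent1_eval_cat /laurent1_eval !big_map /=.
  apply/eqP; rewrite addr_eq0; apply/eqP.
  transitivity (lsum s (pt3 x y (a * z))).
    by rewrite lsum_pt3; apply: eq_bigr => i _; rewrite expfzMl !mulrA.
  rewrite st // lsum_pt3 -sumrN; apply: eq_bigr => i _.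
  by rewrite mulNr opprK !mulrA.
apply/eqP; congr (_ + _); apply: eq_bigr => i /eqP ->.
by rewrite expr0z mulr1.
Qed.

Lemma row3_eq0 (m : 'rV[int]_3) :
  (m == 0) = [&& m 0 2%:R == 0, m 0 0 == 0 & m 0 1 == 0].
Proof.
apply/eqP/and3P => [->|[/eqP m2 /eqP m0 /eqP m1]]; first by rewrite !mxE.
apply/rowP => -[[|[|[|//]]] j3]; rewrite mxE;
  [rewrite -[RHS]m0|rewrite -[RHS]m1|rewrite -[RHS]m2]; congr (m _ _); exact/val_inj.
Qed.

Lemma row2_eq (m m' : 'rV[int]_2) : m 0 0 = m' 0 0 -> m 0 1 = m' 0 1 -> m = m'.
Proof.
move=> m0 m1; apply/rowP => j.
have [->|->] : j = 0 \/ j = 1 by case: j => -[|[|//]] ?; [left|right]; exact/val_inj.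
- exact: m0.
- exact: m1.
Qed.

(** The parts of degree 0 in [z] agree only where [A] is nonzero. Reducing from two variables to one
    makes [laurent1_coef_eq0] applicable, with [A] as the excluded locus. *)
Lemma lconst_shear (A : laurent K 2) (s t : seq (K * 'rV[int]_3)) :
  finsupp A != fset0 ->
  (forall x y z, x != 0 -> y != 0 -> z != 0 ->
    let a := leval A (\row_j tnth [tuple x; y] j) in
    a != 0 -> lsum s (pt3 x y (a * z)) = lsum t (pt3 x y z)) ->
  lconst s = lconst t.
Proof.
move=> /fset0Pn [mA mAin] st.
(* The first bound keeps nonzero exponents of [s] and [t] from being sent to 0; the second keeps
   other exponents of [A] from colliding with [mA], so that [A] stays nonzero after the
   substitution. *)
have [D D_s D_A] : exists2 D : nat,
    forall i, i \in s ++ t -> `|i.2 0 0| < D%:Z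
  & forall m, m \in finsupp A -> `|m 0 0 - mA 0 0| < D%:Z.
  exists (\sum_(i <- s ++ t) absz (i.2 0 0)%R +
    \sum_(m <- finsupp A) absz (m 0 0 - mA 0 0)%R).+1%N.
    by move=> i si; rewrite (big_rem i si) /=; lia.
  by move=> m mi; rewrite (big_rem m mi) /=; lia.
(* Kronecker substitution [y = x ^ D], with [D] too large for cancellation. *)
pose r1 := [seq (i.1, i.2 0 0 + D%:Z * i.2 0 1)
  | i : K * 'rV[int]_3 <- s & i.2 0 2%:R == 0].
pose r2 := [seq (- i.1, i.2 0 0 + D%:Z * i.2 0 1)
  | i : K * 'rV[int]_3 <- t & i.2 0 2%:R == 0].
pose a := [seq (A m, m 0 0 + D%:Z * m 0 1) | m <- finsupp A].
have H0 (c d : int) : `|c| < D%:Z -> (c + D%:Z * d == 0) = (c == 0) && (d == 0).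
  move=> cD; apply/eqP/andP => [|[/eqP-> /eqP->]]; last by rewrite mulr0.
  have [->|d0] := eqVneq d 0; first by rewrite mulr0 addr0 => ->.
  nia.
have := @laurent1_coef_eq0 K (r1 ++ r2) a (mA 0 0 + D%:Z * mA 0 1).
have -> : laurent1_coef a (mA 0 0 + D%:Z * mA 0 1) = A mA.
  rewrite /laurent1_coef big_map /= big_seq_cond.
  rewrite (eq_bigl (fun m => (m \in finsupp A) && (m == mA))); last first.
    move=> m; apply: andb_id2l => mAi; rewrite -subr_eq0.
    rewrite [X in X == 0](_ : _ =
      (m 0 0 - mA 0 0) + D%:Z * (m 0 1 - mA 0 1)); last by ring.
    rewrite H0 ?D_A // !subr_eq0; apply/andP/eqP => [[/eqP m0 /eqP m1]|->//].
    exact: row2_eq.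
  by rewrite -big_seq_cond -big_filter filter_pred1_uniq ?big_seq1 ?fset_uniq.
rewrite mem_finsupp in mAin => /(_ mAin) H.
have {H} := H _ 0.
rewrite laurent1_coef_cat /laurent1_coef !big_map !big_filter_cond /= => H.
 apply/eqP; rewrite -subr_eq0 -[X in _ == X]H.
  apply/eqP; rewrite /lconst -sumrN; congr (_ + _);
  rewrite [LHS]big_seq_cond [RHS]big_seq_cond;
  apply: eq_bigl => i; apply: andb_id2l => si;
  by rewrite row3_eq0 H0 ?D_s // mem_cat si ?orbT.
(* At [y = x ^ D] the lists evaluate to the [z ^ 0] parts of [s] and [t], the latter negated, and to
   [A] at [(x, y)]. Where the last is nonzero, [lzconst_scale] applies. *)
move=> x x0; rewrite /laurent1_eval big_map big_cat !big_map !big_filter /=.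
have y0 : x ^ D%:Z != 0 by exact: expfz_neq0.
have xyE (c : K) (d e : int) : c * x ^ (d + D%:Z * e) = c * (x ^ d * (x ^ D%:Z) ^ e).
  by rewrite exprz_exp expfzDr.
under eq_bigr do rewrite xyE.
rewrite -(big_map (fun m => (A m, m)) xpredT
  (fun i => i.1 * (x ^ i.2 0 0 * (x ^ D%:Z) ^ i.2 0 1))).
rewrite -lsum_pt2 -/(lterms A) lsum_lterms => ax0.
under eq_bigr do rewrite xyE.
under [X in _ + X]eq_bigr do rewrite mulNr xyE.
apply/eqP; rewrite sumrN subr_eq0; apply/eqP.
apply: (lzconst_scale ax0) => z z0; exact: st.
Qed.

(** Moving the two monomial maps onto [f] and [g] leaves a pure shear: the pullback of [f] by [T2]
    is compared with the pullback of [g] by the inverse of [T1]. *)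
Lemma lconst_mutation (phi : ratmap3 K) (f g : laurent K 3) (k : nat) :
  is_mutation phi -> pullback_eq phi f g ->
  lconst (lpow (lterms f) k) = lconst (lpow (lterms g) k).
Proof.
move=> [T1 [S [T2 [[M1 M1u T1E] [A A0 SE] [M2 M2u T2E] phiE]]]] fg.
have M1Vu : invmx M1 \in unitmx by rewrite unitmx_inv.
rewrite -(lconst_lpull _ M2u) -[RHS](lconst_lpull _ M1Vu) -!lpow_lpull.
apply: (lconst_shear A0) => x y z x0 y0 z0 a a0.
set q := pt3 x y z; have q0 : in_torus q by exact: in_torus_pt3.
have q'0 : in_torus (pt3 x y (a * z)) by apply: in_torus_pt3 => //; rewrite mulf_neq0.
rewrite !lsum_lpow // !lsum_lpull // !lsum_lterms; congr (_ ^+ _).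
(* The pullback relation is used at the preimage of [q] under [T1], where [phi] takes the value
   [T2 (S q)]. *)
apply: fg; first exact: torus_monomial_map.
rewrite phiE /pcomp T1E /= SE.
have -> : \row_i monomial (row i M1) (\row_i monomial (row i (invmx M1)) q) = q.
  apply/rowP => j; rewrite mxE -monomial_mulmx // -row_mul mulmxV // row1.
  exact: monomial_delta.
have -> : shear A q = Some (pt3 x y (a * z)).
  by rewrite /shear !mxE /= -/a (negbTE a0).
by rewrite /= T2E.
Qed.
End LaurentSum.

(** * Integrals of bounded complex functions *)

Section ComplexFunctions.
Variables (R : realType) (d : measure_display) (T : measurableType d).
Local Notation C := R[i].
Implicit Types (h k : T -> C).

(** A class closed under ring operations whose members are integrable over every measurable set of
    finite measure; being global, it does not depend on the domain of integration. *)
Definition cbounded h : Prop :=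
  [/\ measurable_fun setT (fun x => complex.Re (h x)),
      measurable_fun setT (fun x => complex.Im (h x)) &
      exists M : R, forall x, `|h x| <= M%:C].

Lemma normc_ge_Im (z : C) : `|complex.Im z|%:C <= `|z|.
Proof.
have := normc_ge_Re (z * 'i%C); rewrite ReiNIm normrN normrM.
by rewrite (_ : `|'i%C| = 1 :> C) ?mulr1 // normc_def /= expr0n add0r expr1n sqrtr1.
Qed.

Lemma norm_Re_le (z : C) (M : R) : `|z| <= M%:C -> `|complex.Re z| <= M.
Proof. by move=> zM; rewrite -lecR (le_trans (normc_ge_Re z)). Qed.

Lemma norm_Im_le (z : C) (M : R) : `|z| <= M%:C -> `|complex.Im z| <= M.
Proof. by move=> zM; rewrite -lecR (le_trans (normc_ge_Im z)). Qed.

Lemma normc_le_ReIm (z : C) :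
  `|z| <= (`|complex.Re z| + `|complex.Im z|)%:C.
Proof.
rewrite normc_def lecR -[leRHS]ger0_norm ?addr_ge0 // -sqrtr_sqr ler_wsqrtr //.
rewrite sqrrD !real_normK ?num_real // lerD2r lerDl.
by rewrite mulrn_wge0 // mulr_ge0.
Qed.

Lemma ReD (x y : C) : complex.Re (x + y) = complex.Re x + complex.Re y.
Proof. by case: x y => [? ?] [? ?]. Qed.
Lemma ImD (x y : C) : complex.Im (x + y) = complex.Im x + complex.Im y.
Proof. by case: x y => [? ?] [? ?]. Qed.
Lemma ReM (x y : C) : complex.Re (x * y) =
  complex.Re x * complex.Re y - complex.Im x * complex.Im y.
Proof. by case: x y => [? ?] [? ?]. Qed.
Lemma ImM (x y : C) : complex.Im (x * y) =
  complex.Re x * complex.Im y + complex.Im x * complex.Re y.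
Proof. by case: x y => [? ?] [? ?]. Qed.

Lemma cbounded_cst (c : C) : cbounded (fun=> c).
Proof.
split; [exact: measurable_cst|exact: measurable_cst|].
exists (complex.Re `|c|) => x; rewrite RRe_real ?normr_real //.
Qed.

Lemma cboundedD h k : cbounded h -> cbounded k -> cbounded (fun x => h x + k x).
Proof.
move=> [hR hI [M hM]] [kR kI [N kN]]; split.
- under eq_fun do rewrite ReD; exact: measurable_funD.
- under eq_fun do rewrite ImD; exact: measurable_funD.
- by exists (M + N) => x; rewrite rmorphD (le_trans (ler_normD _ _)) // lerD.
Qed.

Lemma cboundedM h k : cbounded h -> cbounded k -> cbounded (fun x => h x * k x).
Proof.
move=> [hR hI [M hM]] [kR kI [N kN]]; split.
- under eq_fun do rewrite ReM.
  by apply: measurable_funB; exact: measurable_funM.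
- under eq_fun do rewrite ImM.
  by apply: measurable_funD; exact: measurable_funM.
- by exists (M * N) => x; rewrite rmorphM normrM ler_pM.
Qed.

Lemma cboundedX h n : cbounded h -> cbounded (fun x => h x ^+ n).
Proof.
move=> hb; elim: n => [|n IH]; first exact: cbounded_cst.
under eq_fun do rewrite exprS; exact: cboundedM.
Qed.

Lemma cbounded_sum (I : Type) (s : seq I) (H : I -> T -> C) :
  (forall i, cbounded (H i)) -> cbounded (fun x => \sum_(i <- s) H i x).
Proof.
move=> Hb; elim: s => [|i s IH].
  under eq_fun do rewrite big_nil; exact: cbounded_cst.
under eq_fun do rewrite big_cons; exact: cboundedD.
Qed.

Lemma cboundedV h (M : R) : cbounded h -> (forall x, `|(h x)^-1| <= M%:C) ->
  cbounded (fun x => (h x)^-1).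
Proof.
move=> [hR hI _] hM.
(* The inverse of [z] is its conjugate over its squared modulus. On nonnegative reals, inversion is
   the power function of exponent -1, which is measurable. *)
have mV : measurable_fun setT
    (fun x => ((complex.Re (h x)) ^+ 2 + (complex.Im (h x)) ^+ 2)^-1).
  have -> : (fun x => ((complex.Re (h x)) ^+ 2 + (complex.Im (h x)) ^+ 2)^-1) =
      (fun y => y `^ (-1)) \o
      (fun x => (complex.Re (h x)) ^+ 2 + (complex.Im (h x)) ^+ 2).
    by apply/funext => x /=; rewrite powR_inv1 // addr_ge0 ?sqr_ge0.
  apply: measurableT_comp; first exact: measurable_powR.
  by apply: measurable_funD; exact: measurable_funX.
split; last by exists M.
- rewrite [X in measurable_fun _ X](_ : _ = fun x =>
    complex.Re (h x) * (complex.Re (h x) ^+ 2 + complex.Im (h x) ^+ 2)^-1).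
    exact: measurable_funM.
  by apply/funext => x; case: (h x).
- rewrite [X in measurable_fun _ X](_ : _ = fun x =>
    - (complex.Im (h x) * (complex.Re (h x) ^+ 2 + complex.Im (h x) ^+ 2)^-1)).
    by apply: measurableT_comp => //; exact: measurable_funM.
  by apply/funext => x; case: (h x).
Qed.

Section Integral.
Variables (mu : {measure set T -> \bar R}) (D : set T).
Hypotheses (mD : measurable D) (muD : (mu D < +oo)%E).

Lemma bounded_measurable_integrable (f : T -> R) (M : R) :
  measurable_fun setT f -> (forall x, `|f x| <= M) ->
  mu.-integrable D (EFin \o f).
Proof.
move=> mf fM; apply: measurable_bounded_integrable => //.
  exact: measurable_funTS.
exists M; split; first exact: num_real.
by move=> N MN x _ /=; exact: le_trans (fM x) (ltW MN).
Qed.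

Lemma cbounded_integrable h : cbounded h ->
  mu.-integrable D (EFin \o (fun x => complex.Re (h x))) /\
  mu.-integrable D (EFin \o (fun x => complex.Im (h x))).
Proof.
move=> [hR hI [M hM]]; split; apply: (@bounded_measurable_integrable _ M) => //.
- by move=> x; exact: norm_Re_le.
- by move=> x; exact: norm_Im_le.
Qed.

Lemma CintegralD h k : cbounded h -> cbounded k ->
  Cintegral mu D (fun x => h x + k x) = Cintegral mu D h + Cintegral mu D k.
Proof.
move=> /cbounded_integrable[hR hI] /cbounded_integrable[kR kI].
rewrite /Cintegral; apply/eqP; rewrite eq_complex /=.
rewrite -!RintegralD //; apply/andP; split; apply/eqP; apply: eq_Rintegral => x _.
- exact: ReD.
- exact: ImD.
Qed.

Lemma CintegralZ (c : C) h : cbounded h ->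
  Cintegral mu D (fun x => c * h x) = c * Cintegral mu D h.
Proof.
move=> /cbounded_integrable[hR hI].
have Z (r : R) f : mu.-integrable D (EFin \o f) ->
  mu.-integrable D (EFin \o (fun x => r * f x)).
  move=> fi; rewrite (_ : _ \o _ = fun x => (r%:E * (EFin \o f) x)%E) //.
  exact: integrableZl.
rewrite /Cintegral; apply/eqP; rewrite eq_complex ReM ImM /=.
rewrite -!RintegralZl // -RintegralB ?Z // -RintegralD ?Z //.
apply/andP; split; apply/eqP; apply: eq_Rintegral => x _.
- exact: ReM.
- exact: ImM.
Qed.

Lemma Cintegral_sum (I : Type) (s : seq I) (c : I -> C) (H : I -> T -> C) :
  (forall i, cbounded (H i)) ->
  Cintegral mu D (fun x => \sum_(i <- s) c i * H i x) =
  \sum_(i <- s) c i * Cintegral mu D (H i).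
Proof.
move=> Hb; elim: s => [|i s IH].
  rewrite big_nil /Cintegral; apply/eqP; rewrite eq_complex /=.
  by apply/andP; split; apply/eqP; under eq_Rintegral do rewrite big_nil /=;
    rewrite Rintegral_cst // mul0r.
under eq_fun do rewrite big_cons; rewrite CintegralD.
- by rewrite big_cons IH CintegralZ.
- by apply: cboundedM => //; exact: cbounded_cst.
- by apply: cbounded_sum => j; apply: cboundedM => //; exact: cbounded_cst.
Qed.

Lemma Cintegral_cst (c : C) : Cintegral mu D (fun=> c) = c * (fine (mu D))%:C.
Proof.
apply/eqP; rewrite eq_complex ReM ImM /= !Rintegral_cst //.
by rewrite !mulr0 subr0 add0r !eqxx.
Qed.

(** The factor 2 comes from bounding real and imaginary parts separately; this crude bound is enough
    for a remainder that tends to 0. *)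
Lemma norm_Cintegral_le h (M : R) : cbounded h -> (forall x, `|h x| <= M%:C) ->
  `|Cintegral mu D h| <= (2 * (M * fine (mu D)))%:C.
Proof.
move=> /cbounded_integrable[hR hI] hM; apply: le_trans (normc_le_ReIm _) _.
have bound f : mu.-integrable D (EFin \o f) -> (forall x, `|f x| <= M) ->
    `|Rintegral mu D f| <= M * fine (mu D).
  move=> fi fM; apply: le_trans (le_normr_Rintegral _ _) _ => //.
  rewrite -Rintegral_cst //; apply: le_Rintegral => //.
  - exact: integrable_norm.
  - by apply: (@bounded_measurable_integrable _ `|M|) => // x; exact: measurable_cst.
rewrite lecR mulr2n mulrDl mul1r lerD //= bound // => x.
- exact: norm_Re_le.
- exact: norm_Im_le.
Qed.
End Integral.
End ComplexFunctions.

(** * Fubini for products of functions of separate variables *)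

Section Products.
Variables (R : realType) (d1 d2 : measure_display).
Variables (T1 : measurableType d1) (T2 : measurableType d2).
Local Notation C := R[i].

Lemma cbounded_comp (p : T1 -> T2) (h : T2 -> C) :
  measurable_fun setT p -> cbounded h -> cbounded (fun x => h (p x)).
Proof.
move=> mp [hR hI [M hM]]; split.
- exact: (measurableT_comp hR).
- exact: (measurableT_comp hI).
- by exists M.
Qed.

Variables (m1 : {sigma_finite_measure set T1 -> \bar R}).
Variables (m2 : {sigma_finite_measure set T2 -> \bar R}).

(* The library endows [m1 \x m2] with a [sigma_finite_measure] structure, but
   the canonical instance is not found by unification. *)
Definition product_sigma_finite :
    {sigma_finite_measure set (T1 * T2)%type -> \bar R} :=
  HB.pack (m1 \x m2)%E
    (lebesgue_integral_fubini.measure_function_Measure_isSigmaFinite__to__measure_function_isSFinite m1 m2)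
    (lebesgue_integral_fubini.measure_function_Measure_isSigmaFinite__to__measure_function_isSigmaFinite m1 m2).

Variables (A : set T1) (B : set T2).
Hypotheses (mA : measurable A) (m1A : (m1 A < +oo)%E).
Hypotheses (mB : measurable B) (m2B : (m2 B < +oo)%E).

Lemma product_measure_lty : ((m1 \x m2)%E (A `*` B) < +oo)%E.
Proof. by rewrite product_measure1E // lte_mul_pinfty // ge0_fin_numE. Qed.

Lemma Rintegral_prod (f : T1 -> R) (g : T2 -> R) (M N : R) :
  measurable_fun setT f -> (forall x, `|f x| <= M) ->
  measurable_fun setT g -> (forall x, `|g x| <= N) ->
  Rintegral (m1 \x m2)%E (A `*` B) (fun z => f z.1 * g z.2) =
  Rintegral m1 A f * Rintegral m2 B g.
Proof.
move=> mf fM mg gN.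
pose fg (z : T1 * T2) := f z.1 * g z.2.
have fi := bounded_measurable_integrable mA m1A mf fM.
have gi := bounded_measurable_integrable mB m2B mg gN.
have fgi : (m1 \x m2)%E.-integrable (A `*` B) (EFin \o fg).
  apply: (@bounded_measurable_integrable _ _ _ _ _ _ _ _ (M * N)).
  - exact: measurableX.
  - exact: product_measure_lty.
  - by apply: measurable_funM; exact: measurableT_comp.
  - by move=> x; rewrite normrM ler_pM.
(* Extending the integrand by 0 outside [A * B] turns the integral into one over the whole product
   space, where Fubini applies. *)
rewrite /Rintegral (integral_mkcond _ (EFin \o fg)) -integral12_prod_meas1 /=; last first.
  by apply/(integrable_mkcond _ _).1 => //; exact: measurableX.
rewrite -fineM; try exact: integrable_fin_num.
congr fine.
have E x : (\int[m2]_y ((EFin \o fg) \_ (A `*` B)) (x, y) =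
   ((EFin \o f) \_ A) x * \int[m2]_(y in B) (g y)%:E)%E.
  rewrite [in RHS]patchE; case: ifPn => [|] xA.
    rewrite -integralZl // [RHS]integral_mkcond; apply: eq_integral => y _.
    by rewrite !patchE in_setX xA /= EFinM.
  rewrite mul0e integral0_eq // => y _.
  by rewrite patchE in_setX (negbTE xA).
transitivity (\int[m1]_x (((EFin \o f) \_ A) x * \int[m2]_(y in B) (g y)%:E))%E.
  by apply: eq_integral => x _; exact: E.
rewrite -(fineK (integrable_fin_num mB gi)) integralZr //; last first.
  exact/(integrable_mkcond _ mA).1.
by rewrite -integral_mkcond.
Qed.

Lemma Cintegral_prod (h : T1 -> C) (k : T2 -> C) : cbounded h -> cbounded k ->
  Cintegral (m1 \x m2)%E (A `*` B) (fun z => h z.1 * k z.2) =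
  Cintegral m1 A h * Cintegral m2 B k.
Proof.
move=> [hR hI [M hM]] [kR kI [N kN]].
have hMR x : `|complex.Re (h x)| <= M by exact: norm_Re_le.
have hMI x : `|complex.Im (h x)| <= M by exact: norm_Im_le.
have kNR x : `|complex.Re (k x)| <= N by exact: norm_Re_le.
have kNI x : `|complex.Im (k x)| <= N by exact: norm_Im_le.
have mAB : measurable (A `*` B) by exact: measurableX.
have int (f : T1 -> R) (g : T2 -> R) :
    measurable_fun setT f -> (forall x, `|f x| <= M) ->
    measurable_fun setT g -> (forall x, `|g x| <= N) ->
    (m1 \x m2)%E.-integrable (A `*` B)
      (EFin \o (fun z : T1 * T2 => f z.1 * g z.2)%R).
  move=> mf fM mg gN.
  apply: (@bounded_measurable_integrable _ _ _ _ _ _ _ _ (M * N)) => //.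
  - exact: product_measure_lty.
  - by apply: measurable_funM; exact: measurableT_comp.
  - by move=> x; rewrite normrM ler_pM.
apply/eqP; rewrite eq_complex ReM ImM /=.
rewrite -!(@Rintegral_prod _ _ M N) // -RintegralB -?RintegralD //;
  try solve [exact: (int _ _ hI hMI kR kNR)|exact: (int _ _ hR hMR kI kNI)
            |exact: (int _ _ hI hMI kI kNI)|exact: (int _ _ hR hMR kR kNR)].
by apply/andP; split; apply/eqP; apply: eq_Rintegral => z _; rewrite ?ReM ?ImM.
Qed.
End Products.

(** * Orthogonality of the characters of the circle *)

Section Circle.
Variable R : realType.
Local Notation C := R[i].
Local Notation mu := (@lebesgue_measure R).
Local Notation I := (`[0, 2 * pi]%classic : set R).

Lemma Rintegral_antiderivative (F f : R -> R) (a b : R) : a < b ->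
  continuous f -> (forall x : R, is_derive x 1 F (f x)) ->
  Rintegral mu `[a, b]%classic f = F b - F a.
Proof.
move=> ab cf dF.
have cF : continuous F.
  by move=> x; apply/differentiable_continuous/derivable1_diffP; exact: ex_derive.
rewrite /Rintegral (continuous_FTC2 ab _ _ _ (F := F)) //.
- exact: continuous_subspaceT.
- split=> [x _||].
  + exact: ex_derive.
  + exact/cvg_at_right_filter/cF.
  + exact/cvg_at_left_filter/cF.
- by move=> x _; rewrite derive1E derive_val.
Qed.

Lemma expiD (u v : R) : expi (u + v) = expi u * expi v.
Proof.
by apply/eqP; rewrite eq_complex ReM ImM /= cosD sinD [X in _ && (X == _)]addrC !eqxx.
Qed.

Lemma expi0 : expi 0 = 1 :> C.
Proof. by rewrite /expi cos0 sin0. Qed.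

Lemma norm_expi (u : R) : `|expi u| = 1 :> C.
Proof. by rewrite normc_def /= cos2Dsin2 sqrtr1. Qed.

Lemma expi_neq0 (u : R) : expi u != 0 :> C.
Proof. by rewrite -normr_gt0 norm_expi ltr01. Qed.

Lemma expiX (u : R) (k : int) : expi u ^ k = expi (k%:~R * u).
Proof.
have nat (n : nat) v : expi v ^+ n = expi (n%:R * v) :> C.
  elim: n => [|n IH]; first by rewrite mul0r expi0.
  by rewrite exprS IH -expiD -natr1 mulrDl mul1r addrC.
case: k => n; first by rewrite -exprnP nat.
rewrite NegzE -exprnN nat mulrNz mulNr.
apply: (mulfI (expi_neq0 (n.+1%:R * u))).
by rewrite mulfV ?expi_neq0 // -expiD subrr expi0.
Qed.

Lemma continuous_cosM (k : R) : continuous (fun u => cos (k * u)).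
Proof.
move=> u; apply: continuous_comp; last exact: continuous_cos.
by apply: continuousM; [exact: cst_continuous|].
Qed.

Lemma continuous_sinM (k : R) : continuous (fun u => sin (k * u)).
Proof.
move=> u; apply: continuous_comp; last exact: continuous_sin.
by apply: continuousM; [exact: cst_continuous|].
Qed.

Lemma cbounded_expi (k : int) : cbounded (fun u : R => expi u ^ k).
Proof.
split; last by exists 1 => u; rewrite expiX norm_expi.
- under eq_fun do rewrite expiX /=.
  apply: continuous_measurable_fun; exact: continuous_cosM.
- under eq_fun do rewrite expiX /=.
  apply: continuous_measurable_fun; exact: continuous_sinM.
Qed.

Lemma measure_circle : mu I = (2 * pi)%:E.
Proof. by rewrite lebesgue_measure_itv /= lte_fin mulr_gt0 ?pi_gt0 // sube0. Qed.

Lemma measure_circle_lty : (mu I < +oo)%E.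
Proof. by rewrite measure_circle ltry. Qed.

Lemma Cintegral_expi (k : int) :
  Cintegral mu I (fun u => expi u ^ k) = (k == 0)%:R * (2 * pi)%:C.
Proof.
have [->|k0] := eqVneq k 0.
  by rewrite Cintegral_cst // [X in fine X]measure_circle.
have kR : k%:~R != 0 :> R by rewrite intr_eq0.
(* For nonzero [k], the antiderivatives [sin (k u) / k] and [- cos (k u) / k] take equal values at
   both ends of the full turn, so both integrals vanish. *)
have expi_per : expi (k%:~R * (2 * pi)) = 1 :> C.
  by rewrite -expiX /expi mulr_natl cos2pi sin2pi -[RHS](exp1rz _ k).
have pi2 : (0 : R) < 2 * pi by rewrite mulr_gt0 ?pi_gt0.
have kd (u : R) : is_derive u 1 (fun v : R => k%:~R * v) k%:~R.
  by apply: is_derive_eq; rewrite /GRing.scale /= mulr1.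
rewrite mul0r; apply/eqP; rewrite eq_complex /=; apply/andP; split; apply/eqP.
- transitivity (\int[mu]_(u in I) cos (k%:~R * u)).
    by apply: eq_Rintegral => u _; rewrite expiX.
  have dF (u : R) :
      is_derive u 1 (fun v => k%:~R^-1 * sin (k%:~R * v)) (cos (k%:~R * u)).
    have := is_deriveZ k%:~R^-1 (is_derive1_comp (is_derive_sin (k%:~R * u)) (kd u)).
    by rewrite /GRing.scale /= mulrCA mulVf // mulr1.
  rewrite (Rintegral_antiderivative pi2 (@continuous_cosM k%:~R) dF).
  by have [_ ->] := expi_per; rewrite !mulr0 sin0 mulr0 subr0.
- transitivity (\int[mu]_(u in I) sin (k%:~R * u)).
    by apply: eq_Rintegral => u _; rewrite expiX.
  have dF (u : R) :
      is_derive u 1 (fun v => - k%:~R^-1 * cos (k%:~R * v)) (sin (k%:~R * u)).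
    have := is_deriveZ (- k%:~R^-1) (is_derive1_comp (is_derive_cos (k%:~R * u)) (kd u)).
    by move=> d; apply: (is_derive_eq d); rewrite /GRing.scale /=; field.
  rewrite (Rintegral_antiderivative pi2 (@continuous_sinM k%:~R) dF).
  by have [-> _] := expi_per; rewrite mulr0 cos0 subrr.
Qed.
End Circle.

(** * The period as a power series *)

(* [(T, mu, I, e)] abstracts [R] with the Lebesgue measure, [[0, 2 pi]] and
   [u |-> e^(iu)]; only the orthogonality relations [Cintegral_e] matter. *)
Section TorusSeries.
Variables (R : realType) (d : measure_display) (T : measurableType d).
Local Notation C := R[i].
Variables (mu : {sigma_finite_measure set T -> \bar R}) (I : set T).
Variables (e : T -> C) (L : C).
Hypotheses (mI : measurable I) (muI : (mu I < +oo)%E).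
Hypotheses (e_neq0 : forall u, e u != 0).
Hypotheses (cbounded_e : forall k : int, cbounded (fun u => e u ^ k)).
Hypotheses (Cintegral_e : forall k : int,
  Cintegral mu I (fun u => e u ^ k) = (k == 0)%:R * L).

Local Notation mu3 := ((mu \x mu) \x mu)%E.
Local Notation I3 := ((I `*` I) `*` I).

Definition torus_point (u : T * T * T) : 'rV[C]_3 :=
  pt3 (e u.1.1) (e u.1.2) (e u.2).

Lemma in_torus_point u : in_torus (torus_point u).
Proof. by apply: in_torus_pt3; exact: e_neq0. Qed.

Let mI2 : measurable (I `*` I). Proof. exact: measurableX. Qed.
Let muI2 : ((mu \x mu)%E (I `*` I) < +oo)%E.
Proof. exact: product_measure_lty. Qed.
Let mI3 : measurable I3. Proof. exact: measurableX. Qed.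
Let muI3 : (mu3 I3 < +oo)%E.
Proof. exact: (@product_measure_lty _ _ _ _ _ (product_sigma_finite mu mu) mu). Qed.

Lemma cbounded_monomial2 (k l : int) :
  cbounded (fun u : T * T => e u.1 ^ k * e u.2 ^ l).
Proof.
apply: cboundedM.
- exact: (cbounded_comp measurable_fst (cbounded_e k)).
- exact: (cbounded_comp measurable_snd (cbounded_e l)).
Qed.

Lemma cbounded_monomial (m : 'rV[int]_3) :
  cbounded (fun u => monomial m (torus_point u)).
Proof.
under eq_fun do rewrite monomial_pt3; apply: cboundedM.
- exact: (cbounded_comp measurable_fst (cbounded_monomial2 _ _)).
- exact: (cbounded_comp measurable_snd (cbounded_e _)).
Qed.

Lemma Cintegral_monomial (m : 'rV[int]_3) :
  Cintegral mu3 I3 (fun u => monomial m (torus_point u)) = (m == 0)%:R * L ^+ 3.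
Proof.
rewrite row3_eq0; under eq_fun do rewrite monomial_pt3.
transitivity
    (Cintegral (mu \x mu)%E (I `*` I)
      (fun u => e u.1 ^ m 0 0 * e u.2 ^ m 0 1) *
     Cintegral mu I (fun u => e u ^ m 0 2%:R)).
  exact: (@Cintegral_prod _ _ _ _ _ (product_sigma_finite mu mu) mu _ _
    mI2 muI2 mI muI _ _ (cbounded_monomial2 _ _) (cbounded_e _)).
rewrite (Cintegral_prod mI muI mI muI (cbounded_e _) (cbounded_e _)).
rewrite !Cintegral_e.
by do 3 case: eqP => _; rewrite ?(mul0r, mulr0, mul1r) // !exprS expr0 mulr1 mulrA.
Qed.

Lemma cbounded_leval (f : laurent C 3) : cbounded (fun u => leval f (torus_point u)).
Proof.
apply: cbounded_sum => m; apply: cboundedM; [exact: cbounded_cst|].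
exact: cbounded_monomial.
Qed.

(** Expanding the power into monomials, orthogonality keeps only those of exponent 0. *)
Lemma Cintegral_levalX (f : laurent C 3) n :
  Cintegral mu3 I3 (fun u => leval f (torus_point u) ^+ n) =
  lconst (lpow (lterms f) n) * L ^+ 3.
Proof.
transitivity (Cintegral mu3 I3 (fun u => lsum (lpow (lterms f) n) (torus_point u))).
  congr Cintegral; apply/funext => u.
  by rewrite lsum_lpow ?lsum_lterms //; exact: in_torus_point.
rewrite (Cintegral_sum mI3 muI3 _ (fun i => i.1)
  (H := fun i u => monomial i.2 (torus_point u))); last first.
  by move=> i; exact: cbounded_monomial.
rewrite /lconst mulr_suml [RHS]big_mkcond; apply: eq_bigr => i _.
by rewrite Cintegral_monomial; case: eqP; rewrite ?mul1r ?mul0r ?mulr0.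
Qed.

Lemma half_le_norm1B (w : C) : `|w| <= (2^-1)%:C -> (2^-1)%:C <= `|1 - w|.
Proof.
move=> w2; have := lerB_dist 1 w; rewrite normr1 -(lerD2r `|w|) subrK => H.
rewrite -(lerD2r (2^-1)%:C) -rmorphD /=.
rewrite (_ : 2^-1 + 2^-1 = 1 :> R); last by field.
exact: le_trans H (lerD (lexx _) w2).
Qed.

Lemma norm_inv_le2 (z : C) : (2^-1)%:C <= `|z| -> `|z^-1| <= 2%:C.
Proof.
move=> z2; have h0 : (0 : C) < (2^-1)%:C by rewrite ltcR invr_gt0.
rewrite normfV -[leRHS]invrK -[X in _ <= X^-1]fmorphV lef_pV2 ?posrE //.
exact: lt_le_trans h0 z2.
Qed.

Lemma cbounded_geometric (f : laurent C 3) (t : C) :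
  (forall u, `|t * leval f (torus_point u)| <= (2^-1)%:C) ->
  cbounded (fun u => (1 - t * leval f (torus_point u))^-1).
Proof.
move=> tf; apply: (@cboundedV _ _ _ _ 2) => [|u]; last first.
  exact/norm_inv_le2/half_le_norm1B/tf.
under eq_fun do rewrite -mulN1r; do ![exact: cbounded_cst|exact: cbounded_leval
  |apply: cboundedD|apply: cboundedM].
Qed.

(** A finite geometric sum with explicit remainder avoids exchanging a limit with the integral. *)
Lemma Cintegral_geometric (f : laurent C 3) (t : C) n :
  (forall u, `|t * leval f (torus_point u)| <= (2^-1)%:C) ->
  `|Cintegral mu3 I3 (fun u => (1 - t * leval f (torus_point u))^-1) -
    \sum_(k <- iota 0 n) t ^+ k * (lconst (lpow (lterms f) k) * L ^+ 3)| <=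
  (4 * fine (mu3 I3) * 2^-1 ^+ n)%:C.
Proof.
move=> tf; pose w u := t * leval f (torus_point u).
have wb : cbounded w by apply: cboundedM; [exact: cbounded_cst|exact: cbounded_leval].
have w_neq1 u : 1 - w u != 0.
  by rewrite -normr_gt0 (lt_le_trans _ (half_le_norm1B (tf u))) // ltcR invr_gt0.
have ib : cbounded (fun u => (1 - w u)^-1) by exact: cbounded_geometric.
have rb : cbounded (fun u => w u ^+ n * (1 - w u)^-1).
  by apply: cboundedM => //; exact: cboundedX.
have levb k : cbounded (fun u => leval f (torus_point u) ^+ k).
  exact/cboundedX/cbounded_leval.
have split_inv : (fun u => (1 - w u)^-1) = fun u =>
    \sum_(k <- iota 0 n) t ^+ k * leval f (torus_point u) ^+ k +
    w u ^+ n * (1 - w u)^-1.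
  apply/funext => u; under eq_bigr do rewrite -exprMn.
  rewrite -/(index_iota 0 n) -[n in iota 0 n]subn0 big_mkord.
  apply: (mulIf (w_neq1 u)); rewrite mulrDl mulfVK // mulVf //.
  rewrite mulrC -opprB mulNr -subrX1; ring.
rewrite -[fun u => _]/(fun u => (1 - w u)^-1) split_inv.
rewrite (CintegralD mI3 muI3) //; last first.
  by apply: cbounded_sum => k; apply: cboundedM => //; exact: cbounded_cst.
rewrite (Cintegral_sum mI3 muI3 _ (fun k => t ^+ k)) //.
under eq_bigr do rewrite Cintegral_levalX.
rewrite addrC addKr.
(* The 4 splits into the 2 of [norm_Cintegral_le] and the bound 2 on the inverse of [1 - w]; the
   power of 1/2 bounds [w u ^+ n]. *)
rewrite (_ : _ * _ * _ = 2 * ((2^-1 ^+ n * 2) * fine (mu3 I3))); last by field.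
apply: (norm_Cintegral_le mI3 muI3 rb) => u.
rewrite normrM normrX rmorphM rmorphXn ler_pM ?exprn_ge0 //; last first.
  exact/norm_inv_le2/half_le_norm1B/tf.
by rewrite lerXn2r ?nnegrE // ?(le_trans _ (tf u)).
Qed.

Lemma le0_of_le_halfX (x c : R) : (forall n, x <= c * 2^-1 ^+ n) -> x <= 0.
Proof.
move=> xc; rewrite leNgt; apply/negP => x0.
(* This [n] exceeds [c / x] when [c] is nonnegative, and [n < 2 ^ n]; a negative [c] is
   contradictory at once. *)
have := xc (Num.bound (c / x)); apply/negP; rewrite -ltNge.
rewrite exprVn ltr_pdivrMr ?exprn_gt0 // mulrC -ltr_pdivrMr //.
have [c0|c0] := leP 0 c; last first.
  by rewrite (lt_le_trans (_ : _ < 0)) ?exprn_ge0 // pmulr_llt0 ?invr_gt0.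
apply: (lt_le_trans (archi_boundP _)); first by rewrite divr_ge0 // ltW.
by rewrite -natrX ler_nat ltnW // ltn_expl.
Qed.

(** Both integrals are approximated by the same partial sums, so they differ by at most a constant
    times [2^-1 ^+ n] for every [n]. *)
Lemma Cintegral_inv_eq (f g : laurent C 3) :
  (forall k, lconst (lpow (lterms f) k) = lconst (lpow (lterms g) k)) ->
  exists r : R, 0 < r /\ forall c t : C, `|t| < r%:C ->
    Cintegral mu3 I3 (fun u => c * (1 - t * leval f (torus_point u))^-1) =
    Cintegral mu3 I3 (fun u => c * (1 - t * leval g (torus_point u))^-1).
Proof.
move=> fg; have [_ _ [M fM]] := cbounded_leval f.
have [_ _ [N gN]] := cbounded_leval g.
(* [B] bounds both [f] and [g] on the torus, and the added 1 keeps it positive; then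
   [|t| < 1 / (2 B)] gives [|t f|] and [|t g|] at most 1/2. *)
pose B : R := `|M| + `|N| + 1; have B0 : 0 < B by rewrite ltr_wpDl ?addr_ge0.
exists (2 * B)^-1; split=> [|c t tr]; first by rewrite invr_gt0 mulr_gt0.
have small (h : laurent C 3) (P : R) :
    (forall u, `|leval h (torus_point u)| <= P%:C) ->
    `|P| <= B -> forall u, `|t * leval h (torus_point u)| <= (2^-1)%:C.
  move=> hP PB u; rewrite (_ : 2^-1 = (2 * B)^-1 * B); last first.
    by field; rewrite gt_eqF.
  rewrite normrM rmorphM ler_pM // ?(ltW tr) // (le_trans (hP u)) // lecR.
  exact: le_trans (ler_norm P) PB.
have tf : forall u, `|t * leval f (torus_point u)| <= (2^-1)%:C.
  by apply: small fM _; rewrite /B -addrA lerDl addr_ge0.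
have tg : forall u, `|t * leval g (torus_point u)| <= (2^-1)%:C.
  by apply: small gN _; rewrite /B addrAC lerDr addr_ge0.
rewrite (CintegralZ mI3 muI3 c (cbounded_geometric tf)).
rewrite (CintegralZ mI3 muI3 c (cbounded_geometric tg)).
apply: (congr1 ( *%R c)); apply/eqP; rewrite -subr_eq0 -normr_eq0; set x := _ - _.
suff x0 : complex.Re `|x| <= 0.
  by rewrite eq_le normr_ge0 andbT -(RRe_real (normr_real x)) (lecR _ 0).
apply: (@le0_of_le_halfX _ (2 * (4 * fine (mu3 I3)))) => n.
rewrite -lecR RRe_real ?normr_real // -mulrA mulr2n mulrDl mul1r rmorphD /=.
have := lerD (Cintegral_geometric n tf) (Cintegral_geometric n tg).
apply: le_trans; under [X in _ <= _ + `|_ - X|]eq_bigr do rewrite -fg.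
by rewrite [X in _ <= _ + X]distrC; apply: le_trans (ler_normD _ _); rewrite subrKA.
Qed.
End TorusSeries.

(** In angular coordinates [dx / x] is [i du], so the factors [x], [y], [z] cancel and only the
    constant ['i ^+ 3] remains. *)
Lemma period_torus_point (R : realType) (f : laurent R[i] 3) (t : R[i]) :
  period f t = ((2 * pi)%:C * 'i%C)^-1 ^+ 3 *
    Cintegral ((lebesgue_measure \x lebesgue_measure) \x lebesgue_measure)%E
      ((`[0, 2 * pi]%classic `*` `[0, 2 * pi]%classic) `*` `[0, 2 * pi]%classic)
      (fun u => 'i%C ^+ 3 * (1 - t * leval f (torus_point (@expi R) u))^-1).
Proof.
rewrite /period /torus_integral /=; congr (_ * Cintegral _ _ _).
apply/funext => u; rewrite -/(torus_point (@expi R) u).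
have ? := expi_neq0 u.1.1; have ? := expi_neq0 u.1.2; have ? := expi_neq0 u.2.
by set v := (1 - _)^-1; field; apply/and3P; split.
Qed.

Theorem lemma1 (R : realType) (f g : laurent R[i] 3) (phi : ratmap3 R[i])
    (hphi : is_mutation phi) (hfg : pullback_eq phi f g) :
  exists r : R, 0 < r /\
    forall t : R[i], `|t| < r%:C -> period f t = period g t.
Proof.
have fg k := lconst_mutation k hphi hfg.
have [r [r0 rE]] := Cintegral_inv_eq (mu := @lebesgue_measure R)
  (measurable_itv _) (measure_circle_lty R) (@expi_neq0 R) (@cbounded_expi R)
  (@Cintegral_expi R) fg.
exists r; split=> [|t tr]; first exact: r0.
have E := rE ('i%C ^+ 3) t tr.
rewrite (period_torus_point f) (period_torus_point g).
exact: (congr1 ( *%R (((2 * pi)%:C * 'i%C)^-1 ^+ 3)) E).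
Qed.
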